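(* Let $1 \to \Pi \to \Gamma \to G \to 1$ be a continuous extension of compact Lie groups, let $F$ be a $\Gamma$-space on which $\Pi$ acts effectively, and let $(\sigma: D\to B,\mathcal{C})$ be a $(\Pi;\Gamma)$-bundle with fibre $F$. Then $(\sigma,\mathcal{C})$ satisfies the ECHP (equivariant covering homotopy property) if and only if its associated principal $(\Pi;\Gamma)$-bundle $p: Ass(\sigma,\mathcal{C})\to B$ is an $h\Gamma$-fibration.
   Context: All spaces are compactly generated weak Hausdorff (CGWH); products, pullbacks, subspaces and mapping spaces $Map(-,-)$ are formed in that category. All subgroups of compact Lie groups are closed. $I=[0,1]$ carries the trivial action. $G$-spaces are regarded as $\Gamma$-spaces via $\Gamma\to G$. **Bundles with fibre $F$.** Let $\sigma: D\to B$ be a map of $G$-spaces. A chart for $\sigma$ is a pair $(U,\psi)$ with $U\subset B$ open and $\psi: U\times F\to \sigma^{-1}(U)$ a homeomorphism over $U$. An atlas for $\sigma$ is a set $\mathcal{C}$ of charts such that (1) every $b\in B$ lies in $U$ for some $(U,\psi)\in\mathcal{C}$; (2) if $(U_i,\psi_i),(U_j,\psi_j)\in\mathcal{C}$, $\gamma\in\Gamma$ has image $g\in G$, $u\in U_i$ and $gu\in U_j$, then the composite $$F\cong \{u\}\times F\xrightarrow{\gamma^{-1}}\{u\}\times F\xrightarrow{\psi_j^{-1}g\psi_i}\{gu\}\times F\cong F$$ is multiplication by some $\pi\in\Pi$. A maximal atlas is an atlas not contained in any other atlas. A $(\Pi;\Gamma)$-bundle with fibre $F$ is a map of $G$-spaces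 $\sigma: D\to B$ equipped with a maximal atlas $\mathcal{C}$. A map $F\to D$ is admissible if it factors through a fibre $\sigma^{-1}(b)$ and its composite $F\to\sigma^{-1}(b)\xrightarrow{\psi_i^{-1}}\{b\}\times F\cong F$ with any trivialisation $(U_i,\psi_i)\in\mathcal{C}$, $b\in U_i$, is multiplication by some $\pi\in\Pi$. A map of $(\Pi;\Gamma)$-bundles with fibre $F$ from $\sigma_1: D_1\to B_1$ to $\sigma_2: D_2\to B_2$ is a $G$-map $D_1\to D_2$ taking admissible maps to admissible maps; it is displayed as a commuting square together with the $G$-map $B_1\to B_2$ that it covers. If $(\sigma: D\to B,\mathcal{C})$ is such a bundle, then $\sigma\times 1: D\times I\to B\times I$ is regarded as a $(\Pi;\Gamma)$-bundle with fibre $F$ via the unique maximal atlas containing $\{(U\times I,\psi\times 1) : (U,\psi)\in\mathcal{C}\}$. **ECHP.** A $(\Pi;\Gamma)$-bundle $\sigma_2: D_2\to B_2$ with fibre $F$ satisfies the ECHP if, whenever $f: D_1\to D_2$ covering $h: B_1\to B_2$ is a map of $(\Pi;\Gamma)$-bundles with fibre $F$ from some $\sigma_1: D_1\to B_1$ to $\sigma_2$, and $H: B_1\times I\to B_2$ is a $G$-homotopy starting at $h$, there is a map of $(\Pi;\Gamma)$-bundles with fibre $F$, $K: D_1\times I\to D_2$, from $\sigma_1\times 1$ to $\sigma_2$, covering $H$, which restricts to the original map of bundles at $0\in I$. **Associated principal bundle.** If $F\neq\emptyset$, $Ass(\sigma,\mathcal{C})$ is the subspace of $Map(F,D)$ consisting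 of the admissible maps, with $\Gamma$ acting by conjugation, $(\gamma\cdot\varphi)(x)=g\varphi(\gamma^{-1}x)$, where $g$ is the image of $\gamma$ in $G$; the map $p: Ass(\sigma,\mathcal{C})\to B$ sends an admissible map with image in $\sigma^{-1}(b)$ to $b$ (it is identified with the quotient map by $\Pi$). If $F=\emptyset$ (so that $\Pi=1$ and $\Gamma=G$), $Ass(\sigma,\mathcal{C}):=B$ and $p$ is the identity. **Fibrations.** A map of $\Gamma$-spaces is an $h\Gamma$-fibration (Hurewicz $\Gamma$-fibration) if it has the right lifting property, in the category of $\Gamma$-spaces, with respect to all inclusions $X\times\{0\}\to X\times I$, where $X$ is a $\Gamma$-space. $\Gamma$ acts on $B$ via $\Gamma\to G$. *)

(* Defs.v *)
From HB Require Import structures.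
From mathcomp Require Import all_boot all_order all_algebra finmap.
From mathcomp Require Import all_classical all_reals all_analysis.
Import numFieldNormedType.Exports.

Set Implicit Arguments.
Unset Strict Implicit.
Unset Printing Implicit Defensive.
Import Order.TTheory GRing.Theory Num.Theory.

Local Open Scope classical_set_scope.

Definition compact_hausdorff (K : topologicalType) : Prop :=
  compact [set: K] /\ hausdorff_space K.

Definition k_open (X : topologicalType) (A : set X) : Prop :=
  forall K : topologicalType, compact_hausdorff K ->
  forall u : K -> X, continuous u -> open (u @^-1` A).

Definition compactly_generated (X : topologicalType) : Prop :=
  forall A : set X, k_open A -> open A.

Definition weak_hausdorff (X : topologicalType) : Prop :=
  forall K : topologicalType, compact_hausdorff K ->
  forall u : K -> X, continuous u -> closed (range u).

HB.mixin Record isCGWH X of Topological X := {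
  cg_subproof : compactly_generated X;
  wh_subproof : weak_hausdorff X
}.

#[short(type="cgwhType")]
HB.structure Definition CGWH := {X of isCGWH X & Topological X}.

Lemma contP (X Y : topologicalType) (f : X -> Y) :
  continuous f <-> forall A, open A -> open (f @^-1` A).
Proof. exact: topology_structure.continuousP. Qed.

Lemma cont_comp (X Y Z : topologicalType) (f : X -> Y) (g : Y -> Z) :
  continuous f -> continuous g -> continuous (fun x => g (f x)).
Proof. by move=> cf cg x; apply: continuous_comp; [exact: cf|exact: cg]. Qed.

Lemma cont_pair (X Y Z : topologicalType) (f : X -> Y) (g : X -> Z) :
  continuous f -> continuous g -> continuous (fun x => (f x, g x)).
Proof. by move=> cf cg x; apply: cvg_pair; [exact: cf|exact: cg]. Qed.

Lemma cont_fst (X Y : topologicalType) : continuous (@fst X Y).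
Proof. by move=> [x y]; exact: cvg_fst. Qed.

Lemma cont_snd (X Y : topologicalType) : continuous (@snd X Y).
Proof. by move=> [x y]; exact: cvg_snd. Qed.

Lemma cont_cst (X Y : topologicalType) (y : Y) : continuous (fun _ : X => y).
Proof. by move=> x; exact: cvg_cst. Qed.

Lemma hausdorff_prod (K L : topologicalType) :
  hausdorff_space K -> hausdorff_space L -> hausdorff_space (K * L)%type.
Proof.
move=> hK hL [a b] [c d] cl; congr pair.
- apply: hK => A B nA nB.
  have [] := cl (fst @^-1` A) (fst @^-1` B).
  + exact: (@cont_fst K L (a, b)).
  + exact: (@cont_fst K L (c, d)).
  by move=> [x y] [/= ? ?]; exists x.
- apply: hL => A B nA nB.
  have [] := cl (snd @^-1` A) (snd @^-1` B).
  + exact: (@cont_snd K L (a, b)).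
  + exact: (@cont_snd K L (c, d)).
  by move=> [x y] [/= ? ?]; exists y.
Qed.

Lemma ch_prod (K L : topologicalType) :
  compact_hausdorff K -> compact_hausdorff L -> compact_hausdorff (K * L)%type.
Proof.
move=> [cK hK] [cL hL]; split; last exact: hausdorff_prod.
have -> : [set: (K * L)%type] = [set: K] `*` [set: L] by apply/seteqP; split.
exact: compact_setX.
Qed.

Lemma cont_val (X : topologicalType) (A : set X) :
  continuous (fun x : set_type A => \val x : X).
Proof. exact: (@initial_continuous (set_type A) X set_val). Qed.

Lemma cont_to_sub (X Y : topologicalType) (A : set X) (f : Y -> set_type A) :
  continuous (fun y => \val (f y) : X) -> continuous f.
Proof. by move=> cf; apply: (@continuous_comp_initial (set_type A) Y X set_val). Qed.

Lemma ch_sub (X : topologicalType) (A : set X) :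
  compact A -> hausdorff_space X -> compact_hausdorff (set_type A).
Proof.
move=> cA hX; split; last first.
  move=> x y cl; apply: val_inj; apply: hX => U V nU nV.
  have [] := cl ((fun z : set_type A => \val z : X) @^-1` U)
                ((fun z : set_type A => \val z : X) @^-1` V).
  - exact: (@cont_val X A x).
  - exact: (@cont_val X A y).
  by move=> z [? ?]; exists (\val z).
move=> F PF _.
have FA : (fmap (fun z : set_type A => \val z : X) F) A.
  by rewrite /fmap /=; apply: filterS filterT => z _; exact: set_mem (valP z).
have [a [Aa cla]] := cA _ (fmap_proper_filter _ PF) FA.
exists (SigSub (mem_set Aa)); split=> // U V FU /=.
rewrite nbhsE => -[W [[W' oW' <-] W'a] WV].
have [] := cla [set \val u | u in U] W'.
- by rewrite /fmap /=; apply: filterS FU => u Uu; exists u.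
- by apply: open_nbhs_nbhs; split.
by move=> _ [[u Uu <-] W'u]; exists u; split=> //; apply: WV.
Qed.

Lemma ch_cg (K : topologicalType) : compact_hausdorff K -> compactly_generated K.
Proof. by move=> chK A kA; apply: (kA K chK id) => x; exact: cvg_id. Qed.

Lemma ch_image (K X : topologicalType) (u : K -> X) :
  compact_hausdorff K -> continuous u -> compact (range u).
Proof.
move=> [cK _] cu; apply: continuous_compact cK.
exact: continuous_subspaceT.
Qed.

Lemma ch_wh (K : topologicalType) : compact_hausdorff K -> weak_hausdorff K.
Proof.
move=> [_ hK] L chL u cu; apply: compact_closed => //; exact: ch_image.
Qed.

Lemma test_cont (T Y : topologicalType) (f : T -> Y) : compactly_generated T ->
  (forall K : topologicalType, compact_hausdorff K ->
   forall u : K -> T, continuous u -> continuous (fun k => f (u k))) ->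
  continuous f.
Proof.
move=> cgT tf; apply/contP => A oA; apply: cgT => K chK u cu.
by have /contP := tf K chK u cu; exact.
Qed.

Lemma ch_nbhs_compact (K : topologicalType) (x : K) (A : set K) :
  compact_hausdorff K -> nbhs x A ->
  exists V : set K, [/\ nbhs x V, compact V & V `<=` A].
Proof.
move=> [cK hK] nA.
have [V nV clV] := compact_regular hK cK filterT nA.
exists (closure V); split=> //.
  by apply: filterS nV; exact: subset_closure.
by apply: subclosed_compact cK _ => //; exact: closed_closure.
Qed.

Lemma wh_point_closed (X : topologicalType) (x : X) :
  weak_hausdorff X -> closed [set x].
Proof.
move=> wX.
have chB : compact_hausdorff bool.
  by split; [exact: bool_compact|exact: discrete_hausdorff].
suff <- : range (fun _ : bool => x) = [set x] by apply: (wX _ chB); exact: cont_cst.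
by apply/seteqP; split=> [_ [_ _ <-]//|_ ->]; exists true.
Qed.

Lemma wh_pullback_closed (X K L : topologicalType) (a : K -> X) (c : L -> X) :
  weak_hausdorff X -> compact_hausdorff K -> compact_hausdorff L ->
  continuous a -> continuous c -> closed [set z : (K * L)%type | a z.1 = c z.2].
Proof.
move=> wX chK chL ca cc; rewrite -openC openE => -[k l] /= nkl.
have oc : open (c @^-1` ~` [set a k]).
  by move/contP: cc; apply; apply: closed_openC; exact: wh_point_closed.
have [V [nV cV VA]] := ch_nbhs_compact chL
  (open_nbhs_nbhs (conj oc (fun e => nkl (esym e)) : open_nbhs l _)).
have chV := ch_sub cV chL.2.
have clV : closed (range (fun v : set_type V => c (\val v))).
  by apply: (wX _ chV); apply: cont_comp cc; exact: cont_val.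
have nW : nbhs k (a @^-1` (~` range (fun v : set_type V => c (\val v)))).
  apply: open_nbhs_nbhs; split; first by move/contP: ca; apply; exact: closed_openC.
  by move=> -[v _ /= ev]; apply: (VA (\val v)) => //; exact: set_mem (valP v).
exists (a @^-1` (~` range (fun v : set_type V => c (\val v))), V); first by split.
move=> [x y] [/= nx Vy] e; apply: nx; exists (SigSub (mem_set Vy)) => //=.
Qed.

Lemma closed_proj (K L : topologicalType) (A : set (K * L)%type) :
  compact [set: K] -> closed A -> closed [set l | exists k, A (k, l)].
Proof.
move=> /compact_near_coveringP nc clA; rewrite -openC openE => l /= nl.
have := nc L (nbhs l) (fun l k => ~ A (k, l)) (nbhs_filter l).
have near k : [set: K] k -> \near k & l, ~ A (k, l).
  move=> _; have oA := closed_openC clA.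
  have : nbhs (k, l) (~` A).
    by apply: open_nbhs_nbhs; split=> // h; apply: nl; exists k.
  case=> -[U V] [nU nV] UV; exists (U, V) => // -[x y] [/= Ux Vy].
  exact: (UV (x, y)).
by move=> /(_ near) nV; apply: filterS nV => y Vy [k]; exact: Vy.
Qed.

Section Kification.
Variable X : topologicalType.

Definition kify : Type := X.

HB.instance Definition _ := Choice.on kify.

Lemma k_openT : k_open [set: X].
Proof. by move=> K _ u _; rewrite preimage_setT; exact: openT. Qed.

Lemma k_openI : setI_closed (@k_open X).
Proof.
by move=> A B kA kB K chK u cu; rewrite preimage_setI; apply: openI;
  [exact: kA|exact: kB].
Qed.

Lemma k_open_bigcup (I : Type) (f : I -> set X) :
  (forall i, k_open (f i)) -> k_open (\bigcup_i f i).
Proof.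
move=> kf K chK u cu; rewrite preimage_bigcup; apply: bigcup_open => i _.
exact: kf.
Qed.

HB.instance Definition _ :=
  isOpenTopological.Build kify k_openT k_openI k_open_bigcup.

End Kification.

Lemma kify_openE (X : topologicalType) (A : set (kify X)) :
  open A <-> k_open (A : set X).
Proof. by []. Qed.

Lemma of_kify_cont (X : topologicalType) : continuous (fun x : kify X => x : X).
Proof.
apply/contP => A oA; apply/kify_openE => K chK u cu.
by move/contP : cu; exact.
Qed.

Lemma to_kify_cont (T X : topologicalType) (f : T -> X) :
  compactly_generated T -> continuous f -> continuous (f : T -> kify X).
Proof.
move=> cgT cf; apply/contP => A /kify_openE kA; apply: cgT => K chK u cu.
exact: (kA K chK (fun k => f (u k)) (cont_comp cu cf)).
Qed.

Lemma kify_cg (X : topologicalType) : compactly_generated (kify X).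
Proof.
move=> A kA; apply/kify_openE => K chK u cu.
apply: (kA K chK u); apply: to_kify_cont cu; exact: ch_cg.
Qed.

Definition k_diagonal (X : topologicalType) : Prop :=
  forall K L : topologicalType, compact_hausdorff K -> compact_hausdorff L ->
  forall (a : K -> X) (c : L -> X), continuous a -> continuous c ->
  closed [set z : (K * L)%type | a z.1 = c z.2].

Lemma wh_k_diagonal (X : topologicalType) : weak_hausdorff X -> k_diagonal X.
Proof. by move=> wX K L chK chL a c; exact: wh_pullback_closed. Qed.

Lemma kify_wh (X : topologicalType) : k_diagonal X -> weak_hausdorff (kify X).
Proof.
move=> dX K chK u cu; rewrite -openC; apply/kify_openE => L chL v cv.
have clA := dX K L chK chL _ _ (cont_comp cu (@of_kify_cont X)) cv.
have := closed_openC (closed_proj chK.1 clA).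
congr open; apply/seteqP; split=> l /= nl.
  by move=> [k _ e]; apply: nl; exists k.
by move=> [k e]; apply: nl; exists k.
Qed.

(** Products and subspaces in the category of CGWH spaces are the k-ifications of
    the usual product and subspace topologies. *)
Definition kprod (X Y : topologicalType) : Type := kify (X * Y)%type.

HB.instance Definition _ (X Y : topologicalType) :=
  Topological.copy (kprod X Y) (kify (X * Y)%type).

Lemma kprod_wh (X Y : topologicalType) :
  weak_hausdorff X -> weak_hausdorff Y -> weak_hausdorff (kprod X Y).
Proof.
move=> /wh_k_diagonal dX /wh_k_diagonal dY; apply: kify_wh.
move=> K L chK chL a c ca cc.
have clX := dX K L chK chL _ _ (cont_comp ca (@cont_fst X Y))
  (cont_comp cc (@cont_fst X Y)).
have clY := dY K L chK chL _ _ (cont_comp ca (@cont_snd X Y))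
  (cont_comp cc (@cont_snd X Y)).
have := closedI clX clY; congr closed; apply/seteqP; split=> -[k l] /=.
  by move=> [e1 e2]; rewrite [LHS]surjective_pairing e1 e2 -surjective_pairing.
by move=> ->.
Qed.

HB.instance Definition _ (X Y : cgwhType) :=
  isCGWH.Build (kprod X Y) (@kify_cg (X * Y)%type)
    (kprod_wh (@wh_subproof X) (@wh_subproof Y)).

Lemma kfst_cont (X Y : topologicalType) : continuous (fun z : kprod X Y => z.1).
Proof. exact: cont_comp (@of_kify_cont _) (@cont_fst X Y). Qed.

Lemma ksnd_cont (X Y : topologicalType) : continuous (fun z : kprod X Y => z.2).
Proof. exact: cont_comp (@of_kify_cont _) (@cont_snd X Y). Qed.

Lemma kpair_cont (T X Y : topologicalType) (f : T -> X) (g : T -> Y) :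
  compactly_generated T -> continuous f -> continuous g ->
  continuous (fun t => (f t, g t) : kprod X Y).
Proof. by move=> cgT cf cg; apply: to_kify_cont cgT _; exact: cont_pair. Qed.

Section Subspace.
Variables (X : topologicalType) (A : set X).

Definition ksub : Type := kify (set_type A).

HB.instance Definition _ := Topological.copy ksub (kify (set_type A)).

Definition kval (a : ksub) : X := \val (a : set_type A).

Definition kmk (x : X) (Ax : A x) : ksub := SigSub (mem_set Ax) : set_type A.

Lemma kvalP (a : ksub) : A (kval a).
Proof. exact: set_mem (valP (a : set_type A)). Qed.

Lemma kval_inj : injective kval.
Proof. by move=> a b e; apply: val_inj. Qed.

Lemma kval_cont : continuous kval.
Proof. exact: cont_comp (@of_kify_cont _) (@cont_val X A). Qed.

Lemma kmk_cont (T : topologicalType) (f : T -> X) (Af : forall t, A (f t)) :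
  compactly_generated T -> continuous f -> continuous (fun t => kmk (Af t)).
Proof. by move=> cgT cf; apply: to_kify_cont cgT _; exact: cont_to_sub. Qed.

Lemma ksub_wh : weak_hausdorff X -> weak_hausdorff ksub.
Proof.
move=> /wh_k_diagonal dX; apply: kify_wh => K L chK chL a c ca cc.
have := dX K L chK chL _ _ (cont_comp ca (@cont_val X A))
  (cont_comp cc (@cont_val X A)).
congr closed; apply/seteqP; split=> -[k l] /=; first by move=> e; apply: val_inj.
by move=> ->.
Qed.

End Subspace.

HB.instance Definition _ (X : cgwhType) (A : set X) :=
  isCGWH.Build (ksub A) (@kify_cg (set_type A)) (ksub_wh (@wh_subproof X)).

(** The subbase of [cmap X Y] consists of the sets W(u, U) of the continuous
    maps f with f(u(K)) contained in U, for u : K -> X a test map and U open. *)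
Section MappingSpace.
Variables X Y : topologicalType.

Definition cmap : Type := continuousType X Y.

HB.instance Definition _ := Choice.on cmap.

Definition cmap_fun (f : cmap) : X -> Y := f.

Definition cmap_subbase : set (set cmap) :=
  [set W | exists (K : topologicalType) (u : K -> X) (U : set Y),
     [/\ compact_hausdorff K, continuous u, open U &
         W = [set f : cmap | forall k, U (cmap_fun f (u k))]]].

HB.instance Definition _ :=
  isSubBaseTopological.Build cmap cmap_subbase id.

Lemma cmap_subbase_open (W : set cmap) : cmap_subbase W -> open W.
Proof.
move=> sW; exists [set W]; last by rewrite bigcup_set1.
move=> _ ->; exists [fset W]%fset.
  by move=> V /fset1P ->; rewrite inE.
apply/seteqP; split=> [f /(_ W)|f Wf V] /=; first by apply; exact: fset11.
by move=> /fset1P ->.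
Qed.

Lemma cont_to_cmap (T : topologicalType) (h : T -> cmap) :
  (forall W, cmap_subbase W -> open (h @^-1` W)) -> continuous h.
Proof.
move=> hW; apply/contP => _ [D' sD' <-]; rewrite preimage_bigcup.
apply: bigcup_open => V /sD' [E sE <-]; rewrite preimage_bigcap openE => t ht.
apply: filter_bigI => W WE; apply: open_nbhs_nbhs; split; last exact: ht.
by apply: hW; have := sE _ WE; rewrite inE.
Qed.

Lemma eval_test (K : topologicalType) (u : K -> cmap) (v : K -> X) :
  compact_hausdorff K -> continuous u -> continuous v ->
  continuous (fun k => cmap_fun (u k) (v k)).
Proof.
move=> chK cu cv; apply/contP => U oU; rewrite openE => k0 /= Uk0.
have ck : continuous (fun k => cmap_fun (u k0) (v k)).
  by apply: cont_comp cv _; exact: (@cts_fun _ _ (u k0)).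
have nk : nbhs k0 ((fun k => cmap_fun (u k0) (v k)) @^-1` U).
  by apply: open_nbhs_nbhs; split=> //; move/contP : ck; exact.
have [N [nN cN NU]] := ch_nbhs_compact chK nk.
pose W := [set f : cmap | forall n : set_type N, U (cmap_fun f (v (\val n)))].
have oW : open W.
  apply: cmap_subbase_open.
  exists (set_type N), (fun n => v (\val n)), U; split=> //.
    exact: ch_sub chK.2.
  exact: cont_comp (@cont_val _ N) cv.
have nW : nbhs k0 (u @^-1` W).
  apply: open_nbhs_nbhs; split; first by move/contP : cu; exact.
  by move=> n; apply: (NU (\val n)); exact: set_mem (valP n).
by apply: filterS2 nN nW => k Nk /(_ (SigSub (mem_set Nk))).
Qed.

Lemma curry_test (K : topologicalType) (h : K -> cmap) :
  compact_hausdorff K ->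
  (forall L : topologicalType, compact_hausdorff L -> forall v : L -> X,
   continuous v -> continuous (fun z : (K * L)%type => cmap_fun (h z.1) (v z.2))) ->
  continuous h.
Proof.
move=> chK ch; apply: cont_to_cmap => _ [L [v [U [chL cv oU ->]]]].
have cz := ch L chL v cv.
have clA : closed [set z : (L * K)%type | ~ U (cmap_fun (h z.2) (v z.1))].
  have cs : continuous (fun z : (L * K)%type => cmap_fun (h z.2) (v z.1)).
    have cw : continuous (fun z : (L * K)%type => (z.2, z.1)).
      exact: cont_pair (@cont_snd L K) (@cont_fst L K).
    exact: cont_comp cw cz.
  by rewrite -openC setCK; move/contP : cs; exact.
have := closed_openC (closed_proj chL.1 clA); congr open.
apply/seteqP; split=> k /= nk; last by move=> [l]; apply; exact: nk.
by move=> l; apply: contrapT => n; apply: nk; exists l.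
Qed.

Lemma cmap_k_diagonal : weak_hausdorff Y -> k_diagonal cmap.
Proof.
move=> /wh_k_diagonal dY K L chK chL a c ca cc.
have clx x : closed [set z : (K * L)%type |
    cmap_fun (a z.1) x = cmap_fun (c z.2) x].
  apply: (dY K L chK chL (fun k => cmap_fun (a k) x) (fun l => cmap_fun (c l) x)).
    exact: eval_test chK ca (@cont_cst _ _ x).
  exact: eval_test chL cc (@cont_cst _ _ x).
have := @closed_bigI _ _ setT _ (fun x _ => clx x); congr closed.
apply/seteqP; split=> -[k l] /=; last by move=> e x _ /=; rewrite e.
by move=> e; apply/continuousEP => x; exact: (e x I).
Qed.

Definition kmap : Type := kify cmap.

HB.instance Definition _ := Topological.copy kmap (kify cmap).

Definition kapp (f : kmap) : X -> Y := cmap_fun f.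

Definition kabs (f : X -> Y) (cf : continuous f) : kmap :=
  (mkcts cf : continuousType X Y).

Lemma kapp_cont (f : kmap) : continuous (kapp f).
Proof. exact: (@cts_fun _ _ (f : continuousType X Y)). Qed.

Lemma kapp_inj : injective kapp.
Proof. by move=> f g e; apply/continuousEP => x; exact: (congr1 (@^~ x) e). Qed.

Lemma keval_cont : continuous (fun z : kprod kmap X => kapp z.1 z.2).
Proof.
apply: test_cont; first exact: kify_cg.
move=> K chK u cu; apply: eval_test => //.
  apply: cont_comp (@of_kify_cont cmap).
  exact: cont_comp cu (@kfst_cont kmap X).
exact: cont_comp cu (@ksnd_cont kmap X).
Qed.

Lemma kcurry_cont (T : topologicalType) (h : T -> kmap) : compactly_generated T ->
  continuous (fun z : kprod T X => kapp (h z.1) z.2) -> continuous h.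
Proof.
move=> cgT ch; apply: to_kify_cont => //.
apply: test_cont => // K chK u cu; apply: curry_test => // L chL v cv.
apply: (@cont_comp _ _ _ (fun z : (K * L)%type => (u z.1, v z.2) : kprod T X) _ _ ch).
apply: kpair_cont; first exact: ch_cg (ch_prod chK chL).
  exact: cont_comp (@cont_fst K L) cu.
exact: cont_comp (@cont_snd K L) cv.
Qed.

End MappingSpace.

HB.instance Definition _ (X : topologicalType) (Y : cgwhType) :=
  isCGWH.Build (kmap X Y) (@kify_cg (cmap X Y))
    (kify_wh (cmap_k_diagonal (@wh_subproof Y))).

Section Interval.
Variable R : realType.

Definition unitI : Type := set_type (`[0%R, 1%R] : set R).

HB.instance Definition _ := Topological.copy unitI (set_type (`[0%R, 1%R] : set R)).

Lemma unitI_ch : compact_hausdorff unitI.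
Proof. by apply: ch_sub; [exact: segment_compact|exact: Rhausdorff]. Qed.

HB.instance Definition _ := isCGWH.Build unitI (ch_cg unitI_ch) (ch_wh unitI_ch).

Fact unitI0_subproof : (0%R : R) \in (`[0%R, 1%R] : set R).
Proof. by rewrite inE /= in_itv /= lexx ler01. Qed.

Definition unitI0 : unitI := SigSub unitI0_subproof.

End Interval.

(** For a compact Hausdorff group, the product topology on [G * G] is already
    compactly generated, so it agrees with [kprod G G]. *)
HB.mixin Record isTopologicalGroup G of Group G & Topological G := {
  mulg_cont : continuous (fun z : (G * G)%type => (z.1 * z.2)%g);
  invg_cont : continuous (fun x : G => (x^-1)%g)
}.

#[short(type="topGroupType")]
HB.structure Definition TopologicalGroup :=
  {G of isTopologicalGroup G & Group G & Topological G}.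

Section LieGroups.
Variable R : realType.

Fixpoint iter_derive (n m : nat) (vs : seq 'rV[R]_n) (f : 'rV[R]_n -> 'rV[R]_m) :
    'rV[R]_n -> 'rV[R]_m :=
  if vs is v :: vs' then fun x => derive (iter_derive vs' f) x v else f.

(** [f] is C^oo on the open set [U]: all its iterated directional derivatives
    exist and are continuous on [U]. *)
Definition smooth_on (n m : nat) (U : set 'rV[R]_n) (f : 'rV[R]_n -> 'rV[R]_m) :
    Prop :=
  forall (vs : seq 'rV[R]_n) (x : 'rV[R]_n), U x ->
    {for x, continuous (iter_derive vs f)} /\
    (forall v, derivable (iter_derive vs f) x v).

(** A homeomorphism from an open subset of [M] to an open subset of R^n; the
    values of [ch_to] and [ch_from] outside these subsets are irrelevant. *)
Record coordinate_chart (n : nat) (M : topologicalType) := CoordinateChart {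
  ch_dom : set M;
  ch_img : set 'rV[R]_n;
  ch_to : M -> 'rV[R]_n;
  ch_from : 'rV[R]_n -> M;
  ch_dom_open : open ch_dom;
  ch_img_open : open ch_img;
  ch_to_img : forall x, ch_dom x -> ch_img (ch_to x);
  ch_from_dom : forall y, ch_img y -> ch_dom (ch_from y);
  ch_toK : forall x, ch_dom x -> ch_from (ch_to x) = x;
  ch_fromK : forall y, ch_img y -> ch_to (ch_from y) = y;
  ch_to_cont : forall x, ch_dom x -> {for x, continuous ch_to};
  ch_from_cont : forall y, ch_img y -> {for y, continuous ch_from}
}.

Definition smooth_atlas (n : nat) (M : topologicalType)
    (A : set (coordinate_chart n M)) : Prop :=
  (forall x : M, exists2 c, A c & ch_dom c x) /\
  (forall c d, A c -> A d ->
     smooth_on [set y | ch_img c y /\ ch_dom d (ch_from c y)]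
               (fun y => ch_to d (ch_from c y))).

Definition smooth_mul (n : nat) (G : topGroupType)
    (A : set (coordinate_chart n G)) : Prop :=
  forall c d e, A c -> A d -> A e ->
    smooth_on
      [set z : 'rV[R]_(n + n) | [/\ ch_img c (lsubmx z), ch_img d (rsubmx z) &
         ch_dom e (ch_from c (lsubmx z) * ch_from d (rsubmx z))%g]]
      (fun z => ch_to e (ch_from c (lsubmx z) * ch_from d (rsubmx z))%g).

Definition smooth_inv (n : nat) (G : topGroupType)
    (A : set (coordinate_chart n G)) : Prop :=
  forall c d, A c -> A d ->
    smooth_on [set y | ch_img c y /\ ch_dom d ((ch_from c y)^-1)%g]
              (fun y => ch_to d ((ch_from c y)^-1)%g).

(** A topological group carries at most one Lie group structure, and continuous
    homomorphisms of Lie groups are smooth, so that being a Lie group is treated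
    as a property of a topological group. *)
Definition lie_group (G : topGroupType) : Prop :=
  exists (n : nat) (A : set (coordinate_chart n G)),
    [/\ smooth_atlas A, smooth_mul A & smooth_inv A].

Definition compact_lie_group (G : topGroupType) : Prop :=
  compact_hausdorff G /\ lie_group G.

End LieGroups.

Record extension (Pi Gam G : topGroupType) := Extension {
  ext_in : {multiplicative Pi -> Gam};
  ext_out : {multiplicative Gam -> G};
  ext_in_cont : continuous ext_in;
  ext_out_cont : continuous ext_out;
  ext_in_inj : injective ext_in;
  ext_exact : forall c : Gam, ext_out c = 1%g <-> exists p : Pi, c = ext_in p;
  ext_out_surj : forall g : G, exists c : Gam, g = ext_out c
}.

Lemma hom1 (G H : groupType) (f : {multiplicative G -> H}) : f 1%g = 1%g.
Proof. by apply: (mulgI (f 1%g)); rewrite -gmulfM !mulg1. Qed.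

Lemma homV (G H : groupType) (f : {multiplicative G -> H}) (x : G) :
  f (x^-1)%g = ((f x)^-1)%g.
Proof. by apply: (mulgI (f x)); rewrite -gmulfM !mulgV hom1. Qed.

Record gspace (G : topGroupType) := GSpace {
  gcarrier :> cgwhType;
  gact : G -> gcarrier -> gcarrier;
  gact1 : forall x, gact 1%g x = x;
  gactM : forall g h x, gact (g * h)%g x = gact g (gact h x);
  gact_cont : continuous (fun z : kprod G gcarrier => gact z.1 z.2)
}.

Notation "g '\bullet' x" := (gact g x) (at level 40, left associativity).

Record gmap (G : topGroupType) (X Y : gspace G) := GMap {
  gfun :> X -> Y;
  gfun_cont : continuous gfun;
  gfun_equiv : forall (g : G) (x : X), gfun (g \bullet x) = g \bullet gfun x
}.

Section GSpaceFacts.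
Variable G : topGroupType.

Lemma gcg (X : gspace G) : compactly_generated X.
Proof. exact: cg_subproof. Qed.

Lemma gactK (X : gspace G) (g : G) (x : X) : (g^-1)%g \bullet (g \bullet x) = x.
Proof. by rewrite -gactM mulVg gact1. Qed.

Lemma gactKV (X : gspace G) (g : G) (x : X) : g \bullet ((g^-1)%g \bullet x) = x.
Proof. by rewrite -gactM mulgV gact1. Qed.

Lemma gact_contr (X : gspace G) (g : G) : continuous (fun x : X => g \bullet x).
Proof.
apply: (@cont_comp _ _ _ (fun x : X => (g, x) : kprod G X) _ _ (@gact_cont G X)).
by apply: kpair_cont; [exact: gcg|exact: cont_cst|move=> x; exact: cvg_id].
Qed.

Definition gid (X : gspace G) : gmap X X :=
  @GMap G X X (fun x => x) (fun x => cvg_id) (fun _ _ => erefl).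

End GSpaceFacts.

Section Cylinder.
Variables (R : realType) (G : topGroupType) (X : gspace G).

Definition cyl_act (g : G) (z : kprod X (unitI R)) : kprod X (unitI R) :=
  (g \bullet z.1, z.2).

Fact cyl_act_cont :
  continuous (fun z : kprod G (kprod X (unitI R)) => cyl_act z.1 z.2).
Proof.
have c2 := @ksnd_cont G (kprod X (unitI R)).
apply: kpair_cont; first exact: kify_cg.
  apply: (@cont_comp _ _ _
    (fun z : kprod G (kprod X (unitI R)) => (z.1, z.2.1) : kprod G X)
    _ _ (@gact_cont G X)).
  apply: kpair_cont; first exact: kify_cg.
    exact: kfst_cont.
  exact: cont_comp c2 (@kfst_cont X (unitI R)).
exact: cont_comp c2 (@ksnd_cont X (unitI R)).
Qed.

Definition cyl : gspace G :=
  @GSpace G (kprod X (unitI R)) cyl_act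
    (fun z => ltac:(by case: z => x t; rewrite /cyl_act /= gact1))
    (fun g h z => ltac:(by case: z => x t; rewrite /cyl_act /= gactM))
    cyl_act_cont.

Definition cyl0 : gmap X cyl.
Proof.
refine (@GMap G X cyl (fun x => (x, unitI0 R) : kprod X (unitI R)) _ _).
  apply: kpair_cont; [exact: gcg|by move=> x; exact: cvg_id|exact: cont_cst].
by [].
Defined.

End Cylinder.

Section CylinderMap.
Variables (R : realType) (G : topGroupType) (X Y : gspace G) (f : gmap X Y).

Definition cyl_map : gmap (cyl R X) (cyl R Y).
Proof.
refine (@GMap G (cyl R X) (cyl R Y)
  (fun z : kprod X (unitI R) => (f z.1, z.2) : kprod Y (unitI R)) _ _).
  apply: kpair_cont; first exact: kify_cg.
    exact: cont_comp (@kfst_cont _ _) (@gfun_cont _ _ _ f).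
  exact: ksnd_cont.
by move=> g [x t]; rewrite /= /cyl_act /= gfun_equiv.
Defined.

End CylinderMap.

(** [infl E X] is the G-space [X] regarded as a Gamma-space via Gamma -> G. *)
Section Inflation.
Variables (Pi Gam G : topGroupType) (E : extension Pi Gam G) (X : gspace G).

Definition infl_act (c : Gam) (x : X) : X := ext_out E c \bullet x.

Fact infl_act_cont : continuous (fun z : kprod Gam X => infl_act z.1 z.2).
Proof.
apply: (@cont_comp _ _ _ (fun z : kprod Gam X => (ext_out E z.1, z.2) : kprod G X)
  _ _ (@gact_cont G X)).
apply: kpair_cont; first exact: kify_cg.
  exact: cont_comp (@kfst_cont _ _) (@ext_out_cont _ _ _ E).
exact: ksnd_cont.
Qed.

Fact infl_act1 (x : X) : infl_act 1%g x = x.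
Proof. by rewrite /infl_act hom1 gact1. Qed.

Definition infl : gspace Gam :=
  @GSpace Gam X infl_act infl_act1
    (fun c d x => ltac:(by rewrite /infl_act gmulfM gactM))
    infl_act_cont.

End Inflation.
Section Bundles.
Variables (R : realType) (Pi Gam G : topGroupType) (E : extension Pi Gam G).
Variable F : gspace Gam.

Definition effective : Prop :=
  forall p : Pi, (forall x : F, ext_in E p \bullet x = x) -> p = 1%g.

Section Atlases.
Variables (D B : gspace G) (sigma : gmap D B).

Record chart := Chart {
  chart_dom : set B;
  chart_dom_open : open chart_dom;
  chart_map : kprod (ksub chart_dom) F -> ksub (sigma @^-1` chart_dom);
  chart_inv : ksub (sigma @^-1` chart_dom) -> kprod (ksub chart_dom) F;
  chart_mapK : cancel chart_map chart_inv;
  chart_invK : cancel chart_inv chart_map;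
  chart_map_cont : continuous chart_map;
  chart_inv_cont : continuous chart_inv;
  chart_over : forall z, sigma (kval (chart_map z)) = kval z.1
}.

Definition chart_fibre (c : chart) (u : ksub (chart_dom c)) (x : F) : D :=
  kval (chart_map (u, x)).

(** For u in U_i, gu in U_j and gamma over g, the composite
    F --gamma^-1--> F --psi_i--> sigma^-1(u) --g--> sigma^-1(gu) --psi_j^-1--> F
    is multiplication by an element of Pi; [chart_map d] has been applied to
    both sides to avoid its inverse. *)
Definition chart_compat (c d : chart) : Prop :=
  forall (gam : Gam) (u : ksub (chart_dom c)) (v : ksub (chart_dom d)),
    kval v = ext_out E gam \bullet kval u ->
    exists p : Pi, forall x : F,
      ext_out E gam \bullet chart_fibre u ((gam^-1)%g \bullet x) =
      chart_fibre v (ext_in E p \bullet x).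

Definition is_atlas (C : set chart) : Prop :=
  (forall b : B, exists2 c, C c & chart_dom c b) /\
  (forall c d, C c -> C d -> chart_compat c d).

Definition is_maximal_atlas (C : set chart) : Prop :=
  is_atlas C /\ forall C', is_atlas C' -> C `<=` C' -> C' = C.

Definition max_atlas (C : set chart) : set chart :=
  [set c | forall d, C d -> chart_compat c d /\ chart_compat d c].

Definition admissible (C : set chart) (phi : F -> D) : Prop :=
  continuous phi /\
  exists b : B, (forall x, sigma (phi x) = b) /\
    forall (c : chart) (u : ksub (chart_dom c)), C c -> kval u = b ->
      exists p : Pi, forall x, phi x = chart_fibre u (ext_in E p \bullet x).

Lemma compat_via (C : set chart) (c d : chart) :
  (forall b : B, exists2 e, C e & chart_dom e b) ->
  (forall e, C e -> chart_compat c e /\ chart_compat e d) -> chart_compat c d.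
Proof.
move=> covC ced gam u v uv; have [e Ce ve] := covC (kval v).
have [/(_ gam u (kmk ve) uv) [p hp] ed] := ced e Ce.
have [|q hq] := ed 1%g (kmk ve) v; first by rewrite hom1 gact1.
exists (q * p)%g => x; rewrite hp gmulfM gactM -hq hom1 gact1.
by rewrite -gactM invg1 mul1g.
Qed.

Lemma max_atlas_sub (C : set chart) : is_atlas C -> C `<=` max_atlas C.
Proof. by move=> [_ aC] c Cc d Cd; split; exact: aC. Qed.

Lemma max_atlas_atlas (C : set chart) : is_atlas C -> is_atlas (max_atlas C).
Proof.
move=> aC; split=> [b|c d Mc Md].
  by have [c Cc cb] := aC.1 b; exists c => //; exact: max_atlas_sub.
apply: compat_via aC.1 _ => e Ce; split; first exact: (Mc e Ce).1.
exact: (Md e Ce).2.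
Qed.

Lemma max_atlas_ub (C C' : set chart) :
  is_atlas C' -> C `<=` C' -> C' `<=` max_atlas C.
Proof. by move=> aC' CC' c C'c d Cd; split; apply: aC'.2 => //; exact: CC'. Qed.

Lemma max_atlas_maximal (C : set chart) :
  is_atlas C -> is_maximal_atlas (max_atlas C).
Proof.
move=> aC; split; first exact: max_atlas_atlas.
move=> C' aC' MC'; apply/seteqP; split=> //; apply: max_atlas_ub => //.
by apply: subset_trans MC'; exact: max_atlas_sub.
Qed.

Lemma max_atlas_unique (C M : set chart) :
  is_atlas C -> is_maximal_atlas M -> C `<=` M -> M = max_atlas C.
Proof.
move=> aC [aM mM] CM; apply/esym/mM; first exact: max_atlas_atlas.
exact: max_atlas_ub.
Qed.

End Atlases.

Arguments chart_fibre {D B sigma} c u x.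

Section CylinderChart.
Variables (D B : gspace G) (sigma : gmap D B) (c : chart sigma).

Let csigma := cyl_map R sigma.
Let cdom : set (cyl R B) := [set z | chart_dom c z.1].

Fact cyl_dom_open : open cdom.
Proof.
have /contP := @kfst_cont B (unitI R).
by apply; exact: chart_dom_open.
Qed.

Let cbase (w : ksub cdom) : ksub (chart_dom c) :=
  kmk (kvalP w : chart_dom c (kval w).1).

Let cbase_cont : continuous cbase.
Proof.
apply: kmk_cont; first exact: kify_cg.
exact: cont_comp (@kval_cont _ cdom) (@kfst_cont B (unitI R)).
Qed.

Fact cyl_fwd_subproof (z : kprod (ksub cdom) F) :
  (csigma @^-1` cdom)
    ((kval (chart_map (cbase z.1, z.2)), (kval z.1).2) : cyl R D).
Proof. by rewrite /= /cdom /= chart_over; exact: (kvalP z.1). Qed.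

Definition cyl_fwd (z : kprod (ksub cdom) F) : ksub (csigma @^-1` cdom) :=
  kmk (cyl_fwd_subproof z).

Fact cyl_fwd_cont : continuous cyl_fwd.
Proof.
apply: kmk_cont; first exact: kify_cg.
have c1 := @kfst_cont (ksub cdom) F.
apply: kpair_cont; first exact: kify_cg.
  have c2 := kpair_cont (@kify_cg _) (cont_comp c1 cbase_cont)
    (@ksnd_cont (ksub cdom) F).
  exact: cont_comp (cont_comp c2 (@chart_map_cont _ _ _ c)) (@kval_cont _ _).
have c3 := cont_comp (@kval_cont _ cdom) (@ksnd_cont B (unitI R)).
exact: cont_comp c1 c3.
Qed.

Let ctot (y : ksub (csigma @^-1` cdom)) : ksub (sigma @^-1` chart_dom c) :=
  kmk (kvalP y : (sigma @^-1` chart_dom c) (kval y).1).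

Let ctot_cont : continuous ctot.
Proof.
apply: kmk_cont; first exact: kify_cg.
exact: cont_comp (@kval_cont _ _) (@kfst_cont D (unitI R)).
Qed.

Fact cyl_bwd_subproof (y : ksub (csigma @^-1` cdom)) :
  cdom ((kval (chart_inv (ctot y)).1, (kval y).2) : cyl R B).
Proof. exact: (kvalP (chart_inv (ctot y)).1). Qed.

Definition cyl_bwd (y : ksub (csigma @^-1` cdom)) : kprod (ksub cdom) F :=
  (kmk (cyl_bwd_subproof y), (chart_inv (ctot y)).2).

Fact cyl_bwd_cont : continuous cyl_bwd.
Proof.
have ci := cont_comp ctot_cont (@chart_inv_cont _ _ _ c).
apply: kpair_cont; first exact: kify_cg.
  apply: kmk_cont; first exact: kify_cg.
  apply: kpair_cont; first exact: kify_cg.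
    have c1 := cont_comp ci (@kfst_cont (ksub (chart_dom c)) F).
    exact: cont_comp c1 (@kval_cont _ _).
  exact: cont_comp (@kval_cont _ _) (@ksnd_cont D (unitI R)).
exact: cont_comp ci (@ksnd_cont (ksub (chart_dom c)) F).
Qed.

Fact cyl_fwdK : cancel cyl_fwd cyl_bwd.
Proof.
move=> z; have e : ctot (cyl_fwd z) = chart_map (cbase z.1, z.2).
  exact: kval_inj.
rewrite /cyl_bwd [RHS]surjective_pairing; congr pair; last by rewrite e chart_mapK.
apply: kval_inj; rewrite [LHS]/= [RHS]surjective_pairing; congr pair.
by rewrite e chart_mapK.
Qed.

Fact cyl_bwdK : cancel cyl_bwd cyl_fwd.
Proof.
move=> y; have e : cbase (cyl_bwd y).1 = (chart_inv (ctot y)).1.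
  exact: kval_inj.
apply: kval_inj; rewrite [LHS]/= [RHS]surjective_pairing; congr pair.
by rewrite e -surjective_pairing chart_invK.
Qed.

Fact cyl_over (z : kprod (ksub cdom) F) : csigma (kval (cyl_fwd z)) = kval z.1.
Proof. by rewrite /= chart_over [RHS]surjective_pairing. Qed.

Definition cyl_chart : chart csigma :=
  Chart cyl_dom_open cyl_fwdK cyl_bwdK cyl_fwd_cont cyl_bwd_cont cyl_over.

End CylinderChart.

Lemma cyl_atlas (D B : gspace G) (sigma : gmap D B) (C : set (chart sigma)) :
  is_atlas C -> is_atlas [set cyl_chart c | c in C].
Proof.
move=> [covC aC]; split=> [[b t]|_ _ [c Cc <-] [d Cd <-] gam u v uv].
  by have [c Cc cb] := covC b; exists (cyl_chart c) => //; exists c.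
have [|p hp] := aC c d Cc Cd gam
    (kmk (kvalP u : chart_dom c (kval u).1)) (kmk (kvalP v : chart_dom d (kval v).1)).
  exact: (congr1 fst uv).
exists p => x; rewrite [RHS]surjective_pairing.
by congr pair; [exact: hp x|exact: esym (congr1 snd uv)].
Qed.

Record bundle := Bundle {
  btot : gspace G;
  bbase : gspace G;
  bproj : gmap btot bbase;
  batlas : set (chart bproj);
  batlas_maximal : is_maximal_atlas batlas
}.

Arguments batlas S : clear implicits, rename.

(** By [max_atlas_maximal], [max_atlas_sub] and [max_atlas_unique], [max_atlas C]
    is the unique maximal atlas containing the atlas [C]. *)
Definition cyl_bundle (S : bundle) : bundle :=
  Bundle (max_atlas_maximal (cyl_atlas (batlas_maximal S).1)).

Definition is_bundle_map (S1 S2 : bundle)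
    (f : gmap (btot S1) (btot S2)) (h : gmap (bbase S1) (bbase S2)) : Prop :=
  (forall d, bproj S2 (f d) = h (bproj S1 d)) /\
  (forall phi : F -> btot S1, admissible (batlas S1) phi ->
     admissible (batlas S2) (fun x => f (phi x))).

Definition ECHP (S2 : bundle) : Prop :=
  forall (S1 : bundle) (f : gmap (btot S1) (btot S2))
    (h : gmap (bbase S1) (bbase S2)), is_bundle_map f h ->
  forall H : gmap (cyl R (bbase S1)) (bbase S2),
    (forall b, H (cyl0 R _ b) = h b) ->
  exists K : gmap (cyl R (btot S1)) (btot S2),
    @is_bundle_map (cyl_bundle S1) S2 K H /\
    (forall d, K (cyl0 R _ d) = f d).

Section Associated.
Variable S : bundle.

Let adm : set (kmap F (btot S)) := [set phi | admissible (batlas S) (kapp phi)].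

Lemma conj_cont (gam : Gam) (phi : F -> btot S) : continuous phi ->
  continuous (fun x => ext_out E gam \bullet phi ((gam^-1)%g \bullet x)).
Proof.
move=> cp; have c1 := cont_comp (@gact_contr Gam F (gam^-1)%g) cp.
exact: cont_comp c1 (@gact_contr G (btot S) (ext_out E gam)).
Qed.

Lemma conj_adm (gam : Gam) (phi : F -> btot S) : admissible (batlas S) phi ->
  admissible (batlas S)
    (fun x => ext_out E gam \bullet phi ((gam^-1)%g \bullet x)).
Proof.
move=> [cp [b [pb adp]]]; split; first exact: conj_cont.
exists (ext_out E gam \bullet b); split=> [x|d v Cd vb].
  by rewrite gfun_equiv pb.
have [covC aC] := (batlas_maximal S).1.
have [c Cc cb] := covC b.
have [p hp] := adp c (kmk cb) Cc erefl.
have [|q hq] := aC c d Cc Cd gam (kmk cb) v; first exact: vb.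
have [r hr] : exists r, (gam * ext_in E p * gam^-1)%g = ext_in E r.
  have h1 : ext_out E (ext_in E p) = 1%g by apply/ext_exact; exists p.
  by apply/ext_exact; rewrite !gmulfM h1 mulg1 -gmulfM mulgV hom1.
exists (q * r)%g => x; rewrite hp gmulfM gactM -hq -hr.
by rewrite -!gactM !mulgA mulVg mul1g.
Qed.

Definition conj_map (gam : Gam) (phi : kmap F (btot S)) : kmap F (btot S) :=
  kabs (@conj_cont gam _ (@kapp_cont _ _ phi)).

Definition ass_act (gam : Gam) (phi : ksub adm) : ksub adm :=
  @kmk _ adm (conj_map gam (kval phi)) (conj_adm gam (kvalP phi)).

Fact ass_act1 phi : ass_act 1%g phi = phi.
Proof.
apply: kval_inj; apply: kapp_inj; apply/funext => x.
by rewrite /= /kapp /cmap_fun /= /mkcts hom1 gact1 invg1 gact1.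
Qed.

Fact ass_actM gam del phi :
  ass_act (gam * del)%g phi = ass_act gam (ass_act del phi).
Proof.
apply: kval_inj; apply: kapp_inj; apply/funext => x.
by rewrite /= /kapp /cmap_fun /= /mkcts gmulfM gactM invgM gactM.
Qed.

Fact ass_act_cont : continuous (fun z : kprod Gam (ksub adm) => ass_act z.1 z.2).
Proof.
apply: kmk_cont; first exact: kify_cg.
apply: kcurry_cont; first exact: kify_cg.
set T := kprod Gam (ksub adm).
have cT := @kfst_cont T F.
have cg : continuous (fun z : kprod T F => z.1.1).
  exact: cont_comp cT (@kfst_cont Gam (ksub adm)).
have cphi : continuous (fun z : kprod T F => kval z.1.2).
  have c1 := cont_comp cT (@ksnd_cont Gam (ksub adm)).
  exact: cont_comp c1 (@kval_cont _ adm).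
have cx := cont_comp (kpair_cont (@kify_cg _) (cont_comp cg (@invg_cont Gam))
  (@ksnd_cont T F)) (@gact_cont Gam F).
have cv := cont_comp (kpair_cont (@kify_cg _) cphi cx) (@keval_cont F (btot S)).
have cq := cont_comp cg (@ext_out_cont _ _ _ E).
exact: cont_comp (kpair_cont (@kify_cg _) cq cv) (@gact_cont G (btot S)).
Qed.

Definition ass_space : gspace Gam := GSpace ass_act1 ass_actM ass_act_cont.

Definition ass_proj (x0 : F) : gmap ass_space (infl E (bbase S)).
Proof.
refine (@GMap Gam ass_space (infl E (bbase S))
  (fun phi : ksub adm => bproj S (kapp (kval phi) x0)) _ _).
  have c1 := kpair_cont (@kify_cg _) (@kval_cont _ adm) (@cont_cst _ F x0).
  have c2 := cont_comp c1 (@keval_cont F (btot S)).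
  exact: cont_comp c2 (@gfun_cont _ _ _ (bproj S)).
move=> gam phi; have [_ [b [pb _]]] := kvalP phi.
by rewrite /= /kapp /cmap_fun /= /mkcts gfun_equiv [in LHS]pb; rewrite [in RHS]pb.
Defined.

Lemma ass_projE (x0 : F) (phi : ksub adm) (x : F) :
  bproj S (kapp (kval phi) x) = ass_proj x0 phi.
Proof. by have [_ [b [pb _]]] := kvalP phi; rewrite /= !pb. Qed.

(** The total space and the projection; for nonempty [F] the projection sends
    [phi] to the image of any point of [F], cf. [ass_projE]. *)
Definition Ass : {P : gspace Gam & gmap P (infl E (bbase S))} :=
  match pselect (exists x : F, True) with
  | left nF => existT _ ass_space (ass_proj (projT1 (cid nF)))
  | right _ => existT _ (infl E (bbase S)) (gid (infl E (bbase S)))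
  end.

Definition ass_total : gspace Gam := projT1 Ass.

Definition ass_p : gmap ass_total (infl E (bbase S)) := projT2 Ass.

End Associated.

End Bundles.

Section Fibrations.
Variables (R : realType) (G : topGroupType).

Definition has_rlp (A X P B : gspace G) (i : gmap A X) (p : gmap P B) : Prop :=
  forall (f : gmap A P) (h : gmap X B), (forall a, p (f a) = h (i a)) ->
  exists l : gmap X P, (forall a, l (i a) = f a) /\ (forall x, p (l x) = h x).

(** [cyl0 R X : X -> X x I] is the inclusion of X = X x {0}. *)
Definition h_fibration (P B : gspace G) (p : gmap P B) : Prop :=
  forall X : gspace G, has_rlp (cyl0 R X) p.

End Fibrations.

(* Main.v *)
Require Import Defs.
From mathcomp Require Import all_boot all_order all_algebra.
From mathcomp Require Import all_classical all_reals all_analysis.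

(** The covering homotopy property of the bundle and the lifting property of
    its associated principal bundle are two ways of phrasing the same lifting
    problem, exchanged by reading a point of Ass(S) as an embedding of F onto a
    fibre of D.

    Suppose that Ass(S2) -> B2 is a fibration, and let f : D1 -> D2 cover h, with
    a homotopy H starting at h. Composition with f is a Gamma-map from Ass(S1) to
    Ass(S2) ([ass_map]), and H pulls back to a Gamma-homotopy on Ass(S1)
    ([ass_homotopy]), so that there is a lift L : Ass(S1) x I -> Ass(S2). Since
    D1 is the quotient of Ass(S1) x F by Pi,
    the formula K(phi(x), t) = L(phi, t)(x) defines the required map. It is
    consistent because L is Pi-equivariant, and it is continuous because the
    charts of S1 provide local sections of Ass(S1) x F -> D1
    ([ass_homotopy_extend], [fibration_ECHP]).

    Conversely, suppose that the ECHP holds. To lift a homotopy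
    H : X x I -> B that starts at the projection of f : X -> Ass(S), one could
    apply the ECHP to a bundle over X/Pi. Instead, it is applied once
    and for all to the universal homotopy: the base is the path space Map(I, B),
    the bundle over it is the pullback of S along evaluation at 0, and the
    homotopy is the evaluation Map(I, B) x I -> B. If K is the resulting map of
    bundles and w_x is the path t |-> H(x, t), then
    y |-> K((w_x, f(x)(y)), t) is an admissible map over H(x, t), and it
    depends continuously and equivariantly on (x, t) ([ECHP_fibration]). This
    avoids quotient spaces altogether.

    If F is empty, every total space is empty and the associated projection is
    an identity map, so that both properties hold. *)

Set Implicit Arguments.
Unset Strict Implicit.
Unset Printing Implicit Defensive.

Local Open Scope classical_set_scope.

(** * Continuity on open subspaces *)

(** The k-ification in the definition of [ksub] is harmless for open [A]: for a
    test map u : K -> X, every point of the preimage of [A] has a compact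
    neighbourhood mapped into [A], and it is a test space for the subspace. *)
Lemma kval_open (X : topologicalType) (A : set X) (W : set (ksub A)) :
  compactly_generated X -> open A -> open W -> open (@kval X A @` W).
Proof.
move=> cgX oA /kify_openE kW; apply: cgX => K chK u cu; rewrite openE => k [a Wa e].
have nA : nbhs k (u @^-1` A).
  apply: open_nbhs_nbhs; split; first by move/contP : cu; exact.
  by rewrite /= -e; exact: kvalP.
have [V [nV cV VA]] := ch_nbhs_compact chK nA.
have AV (v : set_type V) : A (u (\val v)) by apply: VA; exact: set_mem (valP v).
pose v' (v : set_type V) : set_type A := SigSub (mem_set (AV v)).
have cv' : continuous v' by apply: cont_to_sub; exact: cont_comp (@cont_val _ V) cu.
have := kW _ (ch_sub cV chK.2) v' cv'; rewrite openE => ov.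
have Vk : V k by exact: nbhs_singleton.
case: (ov (SigSub (mem_set Vk))) => [/=|].
  suff -> : v' (SigSub (mem_set Vk)) = a by [].
  by apply: val_inj; rewrite /= -e.
move=> N' [[N oN <-] Nk NW].
apply: filterS2 nV (open_nbhs_nbhs (conj oN Nk)) => x Vx Nx /=.
have /= Wx := NW (SigSub (mem_set Vx)) Nx.
by exists (v' (SigSub (mem_set Vx))).
Qed.

Lemma cont_local (X Y : topologicalType) (f : X -> Y) : compactly_generated X ->
  (forall x, exists A : set X,
     [/\ open A, A x & continuous (fun a : ksub A => f (kval a))]) ->
  continuous f.
Proof.
move=> cgX lf; apply/contP => U oU; rewrite openE => x /= Ux.
have [A [oA Ax /contP/(_ U oU) oW]] := lf x.
have oV := kval_open cgX oA oW.
suff : nbhs x (@kval X A @` ((fun a : ksub A => f (kval a)) @^-1` U)).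
  by apply: filterS => _ [a Ua <-].
by apply: open_nbhs_nbhs; split=> //; exists (kmk Ax).
Qed.

Lemma cont_ext (X Y : topologicalType) (f g : X -> Y) :
  f =1 g -> continuous f -> continuous g.
Proof. by move=> /funext ->. Qed.

(** * Invariant subspaces, products and mapping spaces of G-spaces *)

Section GSpaceConstructions.
Variable G : topGroupType.

Section Subspace.
Variables (X : gspace G) (A : set X).
Hypothesis A_stable : forall g x, A x -> A (g \bullet x).

Definition gsub_act (g : G) (a : ksub A) : ksub A := kmk (A_stable g (kvalP a)).

Fact gsub_act1 a : gsub_act 1%g a = a.
Proof. by apply: kval_inj; exact: gact1. Qed.

Fact gsub_actM g h a : gsub_act (g * h)%g a = gsub_act g (gsub_act h a).
Proof. by apply: kval_inj; exact: gactM. Qed.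

Fact gsub_act_cont : continuous (fun z : kprod G (ksub A) => gsub_act z.1 z.2).
Proof.
apply: kmk_cont; first exact: kify_cg.
have c2 := cont_comp (@ksnd_cont G (ksub A)) (@kval_cont _ A).
exact: cont_comp (kpair_cont (@kify_cg _) (@kfst_cont G (ksub A)) c2)
  (@gact_cont G X).
Qed.

Definition gsub : gspace G := GSpace gsub_act1 gsub_actM gsub_act_cont.

End Subspace.

Section Product.
Variables X Y : gspace G.

Definition gprod_act (g : G) (z : kprod X Y) : kprod X Y :=
  (g \bullet z.1, g \bullet z.2).

Fact gprod_act1 z : gprod_act 1%g z = z.
Proof. by case: z => x y; rewrite /gprod_act !gact1. Qed.

Fact gprod_actM g h z : gprod_act (g * h)%g z = gprod_act g (gprod_act h z).
Proof. by rewrite /gprod_act !gactM. Qed.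

Fact gprod_act_cont : continuous (fun z : kprod G (kprod X Y) => gprod_act z.1 z.2).
Proof.
have c1 := @kfst_cont G (kprod X Y).
have c2 := @ksnd_cont G (kprod X Y).
have cx := cont_comp c2 (@kfst_cont X Y).
have cy := cont_comp c2 (@ksnd_cont X Y).
apply: kpair_cont; first exact: kify_cg.
  exact: cont_comp (kpair_cont (@kify_cg _) c1 cx) (@gact_cont G X).
exact: cont_comp (kpair_cont (@kify_cg _) c1 cy) (@gact_cont G Y).
Qed.

Definition gprod : gspace G := GSpace gprod_act1 gprod_actM gprod_act_cont.

End Product.

(** [X] carries the trivial action, so that conjugation reduces to the action on
    the values. *)
Section MappingSpace.
Variables (X : cgwhType) (Y : gspace G).

Definition gmapsp_act (g : G) (w : kmap X Y) : kmap X Y :=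
  kabs (cont_comp (@kapp_cont _ _ w) (@gact_contr G Y g)).

Fact gmapsp_act1 w : gmapsp_act 1%g w = w.
Proof.
by apply: kapp_inj; apply/funext => x; exact: gact1.
Qed.

Fact gmapsp_actM g h w : gmapsp_act (g * h)%g w = gmapsp_act g (gmapsp_act h w).
Proof.
by apply: kapp_inj; apply/funext => x; exact: gactM.
Qed.

Fact gmapsp_act_cont :
  continuous (fun z : kprod G (kmap X Y) => gmapsp_act z.1 z.2).
Proof.
apply: kcurry_cont; first exact: kify_cg.
set T := kprod G (kmap X Y).
have cT := @kfst_cont T X.
have cg := cont_comp cT (@kfst_cont G (kmap X Y)).
have cw := cont_comp cT (@ksnd_cont G (kmap X Y)).
have cv := cont_comp (kpair_cont (@kify_cg _) cw (@ksnd_cont T X))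
  (@keval_cont X Y).
exact: cont_comp (kpair_cont (@kify_cg _) cg cv) (@gact_cont G Y).
Qed.

Definition gmapsp : gspace G := GSpace gmapsp_act1 gmapsp_actM gmapsp_act_cont.

End MappingSpace.
End GSpaceConstructions.

(** * Admissible maps *)

Section Admissible.
Variables (Pi Gam G : topGroupType) (E : extension Pi Gam G) (F : gspace Gam).
Variables (D B : gspace G) (sigma : gmap D B).
Implicit Types (C : set (chart F sigma)) (c : chart F sigma) (phi : F -> D).

Lemma chart_fibre_cont c (u : ksub (chart_dom c)) : continuous (chart_fibre u).
Proof.
have c1 := kpair_cont (@gcg _ F) (@cont_cst F _ u) (fun x : F => cvg_id).
exact: cont_comp (cont_comp c1 (@chart_map_cont _ _ _ _ _ _ c)) (@kval_cont _ _).
Qed.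

Lemma chart_fibre_over c (u : ksub (chart_dom c)) x :
  sigma (chart_fibre u x) = kval u.
Proof. exact: chart_over (u, x). Qed.

Lemma chart_fibre_eq c (u v : ksub (chart_dom c)) x :
  kval u = kval v -> chart_fibre u x = chart_fibre v x.
Proof. by move=> /kval_inj ->. Qed.

Lemma chart_fibre_inj c (u : ksub (chart_dom c)) : injective (chart_fibre u).
Proof.
move=> x y /kval_inj e.
by have /(congr1 snd) := can_inj (@chart_mapK _ _ _ _ _ _ c) e.
Qed.

(** One chart suffices to test admissibility, since the transition to any other
    chart of the atlas is multiplication by an element of Pi. *)
Lemma chart_fibre_admissible C c (u : ksub (chart_dom c)) (p : Pi) phi :
  is_atlas E C -> C c ->
  (forall x, phi x = chart_fibre u (ext_in E p \bullet x)) -> admissible E C phi.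
Proof.
move=> [_ aC] Cc hphi; split.
  have -> : phi = fun x => chart_fibre u (ext_in E p \bullet x) by apply/funext.
  exact: cont_comp (@gact_contr _ F (ext_in E p)) (@chart_fibre_cont c u).
exists (kval u); split=> [x|d v Cd vu]; first by rewrite hphi chart_fibre_over.
(* Compatibility over the same point of the base is the case gamma = 1. *)
have [|q hq] := aC c d Cc Cd 1%g u v; first by rewrite hom1 gact1.
exists (q * p)%g => x; rewrite hphi gmulfM gactM -hq hom1 gact1.
by rewrite invg1 gact1.
Qed.

(** Admissible maps into a bundle whose maximal atlas is generated by explicit
    charts, such as a cylinder or a pullback, can thus be handled with these
    charts only. *)
Lemma admissible_max C phi : is_atlas E C ->
  admissible E (max_atlas E C) phi <-> admissible E C phi.
Proof.
move=> aC; split=> [[cp [b [pb hb]]]|[cp [b [pb hb]]]].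
  split=> //; exists b; split=> // c u Cc; apply: hb.
  exact: max_atlas_sub aC _ Cc.
have [c Cc cb] := aC.1 b; have [p hp] := hb c (kmk cb) Cc erefl.
apply: chart_fibre_admissible (max_atlas_atlas aC) _ hp.
exact: max_atlas_sub aC _ Cc.
Qed.

Lemma admissible_inj C phi : is_atlas E C -> admissible E C phi -> injective phi.
Proof.
move=> aC [_ [b [_ hb]]] x y; have [c Cc cb] := aC.1 b.
have [p hp] := hb c (kmk cb) Cc erefl.
by rewrite !hp => /chart_fibre_inj /(congr1 (fun z => (ext_in E p)^-1%g \bullet z));
  rewrite !gactK.
Qed.

(** Both maps are multiplications by elements of Pi in one chart at their common
    base point, so that the fibres of Ass -> B are Pi-orbits. *)
Lemma admissible_translate C phi psi (x y : F) : is_atlas E C ->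
  admissible E C phi -> admissible E C psi -> sigma (phi x) = sigma (psi y) ->
  exists p : Pi, forall z, psi z = phi (ext_in E p \bullet z).
Proof.
move=> aC [_ [b [pb hb]]] [_ [b' [pb' hb']]]; rewrite pb pb' => ebb'.
have [c Cc cb] := aC.1 b; have [p hp] := hb c (kmk cb) Cc erefl.
have [q hq] := hb' c (kmk cb) Cc ebb'.
by exists (p^-1 * q)%g => z; rewrite hp hq gmulfM homV gactM gactKV.
Qed.

End Admissible.

Section CylinderAdmissible.
Variables (R : realType) (Pi Gam G : topGroupType) (E : extension Pi Gam G).
Variables (F : gspace Gam) (S : bundle E F).

Lemma cyl_admissibleP (phi : F -> cyl R (btot S)) :
  admissible E (batlas (b := cyl_bundle R S)) phi ->
  exists (psi : F -> btot S) (t : unitI R),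
    admissible E (batlas (b := S)) psi /\ phi = fun x => (psi x, t).
Proof.
have aS := (batlas_maximal S).1.
move/(admissible_max _ (cyl_atlas R aS)) => [cp [[b t] [pb hb]]].
exists (fun x => (phi x).1), t; split; last first.
  apply/funext => x; rewrite [LHS]surjective_pairing; congr pair.
  exact: (congr1 snd (pb x)).
have [c Cc cb] := aS.1 b.
(* The chart of the cylinder rebuilds the membership proof of a point of the
   base, so that fibres over equal points are compared by [chart_fibre_eq]. *)
pose w : ksub (chart_dom (cyl_chart R c)) :=
  kmk (cb : chart_dom (cyl_chart R c) (b, t)).
have [p hp] := hb (cyl_chart R c) w (imageP _ Cc) erefl.
apply: (chart_fibre_admissible (p := p) (u := kmk cb) aS Cc) => x.
rewrite -(chart_fibre_eq (u := kmk (kvalP w : chart_dom c (kval w).1))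
  (v := kmk cb)) //.
by have := congr1 fst (hp x).
Qed.

Lemma cyl_admissible (psi : F -> btot S) (t : unitI R) :
  admissible E (batlas (b := S)) psi ->
  admissible E (batlas (b := cyl_bundle R S)) (fun x => (psi x, t) : cyl R (btot S)).
Proof.
have aS := (batlas_maximal S).1; move=> [cp [b [pb hb]]].
apply/(admissible_max _ (cyl_atlas R aS)).
have [c Cc cb] := aS.1 b.
pose w : ksub (chart_dom (cyl_chart R c)) :=
  kmk (cb : chart_dom (cyl_chart R c) (b, t)).
have [p hp] := hb c (kmk (kvalP w : chart_dom c (kval w).1)) Cc erefl.
apply: (chart_fibre_admissible (c := cyl_chart R c) (p := p)
  (u := w) (cyl_atlas R aS)) => [|x].
  by exists c.
by rewrite hp.
Qed.

End CylinderAdmissible.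

(** * Pullback bundles *)

Section Pullback.
Variables (Gam G : topGroupType) (F : gspace Gam).
Variables (D B B' : gspace G) (sigma : gmap D B) (h : gmap B' B).

Definition pb_set : set (gprod B' D) := [set z | h z.1 = sigma z.2].

Fact pb_stable g z : pb_set z -> pb_set (g \bullet z).
Proof. by rewrite /pb_set /= !gfun_equiv => ->. Qed.

Definition pb_tot : gspace G := gsub pb_stable.

Fact pb_fst_cont : continuous (fun z : pb_tot => (kval (A := pb_set) z).1).
Proof. exact: cont_comp (@kval_cont _ _) (@kfst_cont B' D). Qed.

Fact pb_snd_cont : continuous (fun z : pb_tot => (kval (A := pb_set) z).2).
Proof. exact: cont_comp (@kval_cont _ _) (@ksnd_cont B' D). Qed.

Definition pb_proj : gmap pb_tot B' := GMap pb_fst_cont (fun _ _ => erefl).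

Definition pb_map : gmap pb_tot D := GMap pb_snd_cont (fun _ _ => erefl).

Definition pb_mk (b : B') (d : D) (e : h b = sigma d) : pb_tot :=
  @kmk _ pb_set (b, d) e.

Lemma pb_mapE z : sigma (pb_map z) = h (pb_proj z).
Proof. exact/esym/(@kvalP _ pb_set z). Qed.

Lemma pb_inj (z w : pb_tot) :
  pb_proj z = pb_proj w -> pb_map z = pb_map w -> z = w.
Proof.
move=> e1 e2; apply: kval_inj.
by rewrite [LHS]surjective_pairing [RHS]surjective_pairing; congr pair.
Qed.

Lemma pb_mk_cont (T : topologicalType) (b : T -> B') (d : T -> D)
    (e : forall t, h (b t) = sigma (d t)) :
  compactly_generated T -> continuous b -> continuous d ->
  continuous (fun t => pb_mk (e t)).
Proof.
move=> cgT cb cd; apply: kmk_cont => //.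
exact: (kpair_cont cgT cb cd).
Qed.

Section Chart.
Variable c : chart F sigma.

Let dom : set B' := h @^-1` chart_dom c.

Let base (w : ksub dom) : ksub (chart_dom c) :=
  kmk (kvalP w : chart_dom c (h (kval w))).

Let base_cont : continuous base.
Proof.
apply: kmk_cont; first exact: kify_cg.
exact: cont_comp (@kval_cont _ dom) (@gfun_cont _ _ _ h).
Qed.

Fact pb_dom_open : open dom.
Proof. by move/contP : (@gfun_cont _ _ _ h); apply; exact: chart_dom_open. Qed.

Fact pb_fwd_subproof (z : kprod (ksub dom) F) :
  h (kval z.1) = sigma (kval (chart_map (base z.1, z.2))).
Proof. by rewrite chart_over. Qed.

Definition pb_fwd (z : kprod (ksub dom) F) : ksub (pb_proj @^-1` dom) :=
  @kmk _ (pb_proj @^-1` dom) (pb_mk (pb_fwd_subproof z)) (kvalP z.1).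

Fact pb_fwd_cont : continuous pb_fwd.
Proof.
have cgT := @kify_cg (ksub dom * F)%type.
have c1 := @kfst_cont (ksub dom) F.
apply: kmk_cont => //; apply: pb_mk_cont => //.
  exact: cont_comp c1 (@kval_cont _ _).
have c2 := kpair_cont cgT (cont_comp c1 base_cont) (@ksnd_cont (ksub dom) F).
exact: cont_comp (cont_comp c2 (@chart_map_cont _ _ _ _ _ _ c)) (@kval_cont _ _).
Qed.

Fact pb_tot_subproof (y : ksub (pb_proj @^-1` dom)) :
  (sigma @^-1` chart_dom c) (pb_map (kval y)).
Proof. by rewrite /= pb_mapE; exact: (kvalP y). Qed.

Let tot (y : ksub (pb_proj @^-1` dom)) : ksub (sigma @^-1` chart_dom c) :=
  kmk (pb_tot_subproof y).

Let tot_cont : continuous tot.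
Proof.
apply: kmk_cont; first exact: kify_cg.
exact: cont_comp (@kval_cont _ _) pb_snd_cont.
Qed.

Definition pb_bwd (y : ksub (pb_proj @^-1` dom)) : kprod (ksub dom) F :=
  (@kmk _ dom (pb_proj (kval y)) (kvalP y), (chart_inv (tot y)).2).

Fact pb_bwd_cont : continuous pb_bwd.
Proof.
apply: kpair_cont; first exact: kify_cg.
  apply: kmk_cont; first exact: kify_cg.
  exact: cont_comp (@kval_cont _ _) pb_fst_cont.
have ci := cont_comp tot_cont (@chart_inv_cont _ _ _ _ _ _ c).
exact: cont_comp ci (@ksnd_cont (ksub (chart_dom c)) F).
Qed.

Fact pb_fwdK : cancel pb_fwd pb_bwd.
Proof.
move=> z; have e : tot (pb_fwd z) = chart_map (base z.1, z.2) by exact: kval_inj.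
rewrite /pb_bwd [RHS]surjective_pairing; congr pair; first exact: kval_inj.
by rewrite e chart_mapK.
Qed.

Fact pb_bwdK : cancel pb_bwd pb_fwd.
Proof.
move=> y; apply: kval_inj; apply: pb_inj => //.
have e : (base (pb_bwd y).1, (pb_bwd y).2) = chart_inv (tot y).
  rewrite [RHS]surjective_pairing; congr pair; apply: kval_inj.
  by rewrite -[RHS]chart_over chart_invK [RHS]pb_mapE.
have -> : pb_map (kval (pb_fwd (pb_bwd y))) =
    kval (chart_map (base (pb_bwd y).1, (pb_bwd y).2)) by [].
by rewrite e chart_invK.
Qed.

Fact pb_over z : pb_proj (kval (pb_fwd z)) = kval z.1.
Proof. by []. Qed.

Definition pb_chart : chart F pb_proj :=
  Chart pb_dom_open pb_fwdK pb_bwdK pb_fwd_cont pb_bwd_cont pb_over.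

Lemma pb_chart_fibreE (u : ksub (chart_dom pb_chart)) x :
  pb_map (chart_fibre u x) = chart_fibre (base u) x.
Proof. by []. Qed.

End Chart.
End Pullback.

Section PullbackBundle.
Variables (Pi Gam G : topGroupType) (E : extension Pi Gam G) (F : gspace Gam).

Lemma pb_atlas (D B B' : gspace G) (sigma : gmap D B) (h : gmap B' B)
    (C : set (chart F sigma)) :
  is_atlas E C -> is_atlas E [set pb_chart h c | c in C].
Proof.
move=> [covC aC]; split=> [b|_ _ [c Cc <-] [d Cd <-] gam u v uv].
  by have [c Cc cb] := covC (h b); exists (pb_chart h c) => //; exists c.
have [|p hp] := aC c d Cc Cd gam
    (kmk (kvalP u : chart_dom c (h (kval u))))
    (kmk (kvalP v : chart_dom d (h (kval v)))).
  by rewrite [LHS](congr1 h uv) gfun_equiv.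
exists p => x; apply: pb_inj; last exact: hp.
by rewrite gfun_equiv !chart_fibre_over uv.
Qed.

Variables (S : bundle E F) (B' : gspace G) (h : gmap B' (bbase S)).

Definition pb_bundle : bundle E F :=
  Bundle (max_atlas_maximal (pb_atlas h (batlas_maximal S).1)).

Lemma pb_bundle_map : @is_bundle_map _ _ _ E F pb_bundle S (pb_map (bproj S) h) h.
Proof.
split=> [d|phi]; first exact: pb_mapE.
have aS := (batlas_maximal S).1.
move/(admissible_max _ (pb_atlas h aS)) => [cp [b [pb hb]]].
have [c Cc cb] := aS.1 (h b).
pose w : ksub (chart_dom (pb_chart h c)) := @kmk _ (h @^-1` chart_dom c) b cb.
have [p hp] := hb (pb_chart h c) w (imageP _ Cc) erefl.
apply: (chart_fibre_admissible (p := p) (u := kmk cb) aS Cc) => x.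
rewrite -(chart_fibre_eq (u := kmk (kvalP w : chart_dom c (h (kval w))))
  (v := kmk cb)) //.
by have := congr1 (pb_map (bproj S) h) (hp x).
Qed.

(** The point [x0] excludes an empty fibre, for which the base point of an
    admissible map is not determined by the map. *)
Lemma pb_admissible (b : B') (psi : F -> btot S)
    (e : forall x, h b = bproj S (psi x)) (x0 : F) :
  admissible E (batlas (b := S)) psi ->
  admissible E (batlas (b := pb_bundle)) (fun x => pb_mk (e x)).
Proof.
have aS := (batlas_maximal S).1; move=> [cp [b' [pb hb]]].
apply/(admissible_max _ (pb_atlas h aS)).
have [c Cc cb] := aS.1 (h b).
pose w : ksub (chart_dom (pb_chart h c)) := @kmk _ (h @^-1` chart_dom c) b cb.
have [|p hp] := hb c (kmk (kvalP w : chart_dom c (h (kval w)))) Cc.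
  by rewrite -(pb x0) -e.
apply: (chart_fibre_admissible (c := pb_chart h c) (p := p)
  (u := w) (pb_atlas h aS)) => [|x].
  by exists c.
by apply: pb_inj => //; rewrite pb_chart_fibreE; exact: hp.
Qed.

End PullbackBundle.

(** * The associated space *)

Section AssociatedSpace.
Variables (Pi Gam G : topGroupType) (E : extension Pi Gam G) (F : gspace Gam).
Variable S : bundle E F.
Implicit Types (phi psi : ass_space S) (x y : F).

Definition ass_app (phi : ass_space S) : F -> btot S := kapp (kval phi).

Lemma ass_appP phi : admissible E (batlas (b := S)) (ass_app phi).
Proof. exact: (kvalP phi). Qed.

Lemma ass_ext phi psi : (forall x, ass_app phi x = ass_app psi x) -> phi = psi.
Proof. by move=> e; apply: kval_inj; apply: kapp_inj; apply/funext. Qed.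

Definition ass_mk (u : F -> btot S) (a : admissible E (batlas (b := S)) u) :
    ass_space S :=
  @kmk _ [set v | admissible E (batlas (b := S)) (kapp v)] (kabs (proj1 a)) a.

Lemma ass_app_cont :
  continuous (fun z : kprod (ass_space S) F => ass_app z.1 z.2).
Proof.
have c1 := cont_comp (@kfst_cont (ass_space S) F) (@kval_cont _ _).
exact: cont_comp (kpair_cont (@kify_cg _) c1 (@ksnd_cont (ass_space S) F))
  (@keval_cont F (btot S)).
Qed.

Lemma ass_mk_cont (T : topologicalType) (u : T -> F -> btot S)
    (a : forall t, admissible E (batlas (b := S)) (u t)) :
  compactly_generated T -> continuous (fun z : kprod T F => u z.1 z.2) ->
  continuous (fun t => ass_mk (a t)).
Proof. by move=> cgT cu; apply: kmk_cont => //; exact: kcurry_cont. Qed.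

Lemma ass_actE (gam : Gam) phi x :
  ass_app (gam \bullet phi) x = ext_out E gam \bullet ass_app phi (gam^-1%g \bullet x).
Proof. by []. Qed.

Lemma ext_in_out (p : Pi) : ext_out E (ext_in E p) = 1%g.
Proof. by apply/ext_exact; exists p. Qed.

(** With [ass_app_surj], this makes evaluation a bijection from the quotient of
    Ass x F by Pi to D. *)
Lemma ass_app_eq phi psi x y : ass_app phi x = ass_app psi y ->
  exists p : Pi, psi = ext_in E p \bullet phi /\ y = ext_in E p \bullet x.
Proof.
move=> e; have aS := (batlas_maximal S).1.
have [p hp] := admissible_translate aS (ass_appP phi) (ass_appP psi)
  (congr1 (bproj S) e).
exists (p^-1)%g; split.
  by apply: ass_ext => z; rewrite ass_actE ext_in_out gact1 homV invgK hp.
move: e; rewrite hp => /(admissible_inj aS (ass_appP phi)) ->.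
by rewrite homV gactK.
Qed.

(** A chart determines a section of Ass -> B over its domain, and by
    [chart_sectionK] its inverse lifts the points of D over that domain
    continuously to Ass x F. *)
Section ChartSection.
Variable c : chart F (bproj S).
Hypothesis Cc : batlas c.

Fact chart_section_subproof (u : ksub (chart_dom c)) :
  admissible E (batlas (b := S)) (chart_fibre u).
Proof.
apply: (chart_fibre_admissible (p := 1%g) (u := u) (batlas_maximal S).1 Cc) => x.
by rewrite hom1 gact1.
Qed.

Definition chart_section (u : ksub (chart_dom c)) : ass_space S :=
  ass_mk (chart_section_subproof u).

Lemma chart_section_cont : continuous chart_section.
Proof.
apply: ass_mk_cont; first exact: kify_cg.
apply: cont_ext (cont_comp (@chart_map_cont _ _ _ _ _ _ c) (@kval_cont _ _)).
by move=> [u x].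
Qed.

Lemma chart_sectionK (d : ksub (bproj S @^-1` chart_dom c)) :
  ass_app (chart_section (chart_inv d).1) (chart_inv d).2 = kval d.
Proof.
have -> : ass_app (chart_section (chart_inv d).1) (chart_inv d).2 =
  kval (chart_map ((chart_inv d).1, (chart_inv d).2)) by [].
by rewrite -surjective_pairing chart_invK.
Qed.

End ChartSection.

Lemma ass_app_surj (d : btot S) : exists phi x, ass_app phi x = d.
Proof.
have [c Cc cd] := (batlas_maximal S).1.1 (bproj S d).
pose d' : ksub (bproj S @^-1` chart_dom c) := @kmk _ (bproj S @^-1` chart_dom c) d cd.
by exists (chart_section Cc (chart_inv d').1), (chart_inv d').2;
  rewrite chart_sectionK.
Qed.

End AssociatedSpace.

(** * From fibrations to the covering homotopy property *)

Section Extend.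
Variables (R : realType) (Pi Gam G : topGroupType) (E : extension Pi Gam G).
Variables (F : gspace Gam) (S1 S2 : bundle E F).

(** Every point of the cylinder is of the form (phi(x), t), uniquely up to the
    action of Pi on (phi, x); this ambiguity does not affect the value of the
    right-hand side because [L] is Pi-equivariant. *)
Lemma ass_homotopy_extend (L : gmap (cyl R (ass_space S1)) (ass_space S2)) :
  exists K : gmap (cyl R (btot S1)) (btot S2), forall phi x t,
    K (ass_app phi x, t) = ass_app (L (phi, t)) x.
Proof.
have : forall z : cyl R (btot S1), exists d : btot S2, forall phi x,
    ass_app phi x = z.1 -> d = ass_app (L (phi, z.2)) x.
  move=> [d t]; have [phi [x dE]] := ass_app_surj d.
  exists (ass_app (L (phi, t)) x) => psi y /=; rewrite -dE => /esym/ass_app_eq.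
  move=> [p [-> ->]].
  rewrite (gfun_equiv L (ext_in E p) (phi, t)) ass_actE ext_in_out gact1.
  by rewrite gactK.
move=> /choice [K hK].
have KE phi x t : K (ass_app phi x, t) = ass_app (L (phi, t)) x by exact: hK.
have cK : continuous K.
  (* Over a chart, (phi, x) can be chosen to depend continuously on the point. *)
  apply: cont_local; first exact: gcg.
  move=> [d t].
  have [c Cc cd] := (batlas_maximal S1).1.1 (bproj S1 d).
  pose A : set (cyl R (btot S1)) := [set z | chart_dom c (bproj S1 z.1)].
  exists A; split=> //.
    have c1 := cont_comp (@kfst_cont (btot S1) (unitI R))
      (@gfun_cont _ _ _ (bproj S1)).
    by move/contP : c1; apply; exact: chart_dom_open.
  have c1 := cont_comp (@kval_cont _ A) (@kfst_cont (btot S1) (unitI R)).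
  have ct := cont_comp (@kval_cont _ A) (@ksnd_cont (btot S1) (unitI R)).
  pose q (a : ksub A) : ksub (bproj S1 @^-1` chart_dom c) :=
    @kmk _ (bproj S1 @^-1` chart_dom c) (kval a).1 (kvalP a).
  have cq : continuous q by apply: kmk_cont => //; exact: kify_cg.
  have ci := cont_comp cq (@chart_inv_cont _ _ _ _ _ _ c).
  have cs := cont_comp (cont_comp ci (@kfst_cont _ _))
    (@chart_section_cont _ _ _ _ _ _ c Cc).
  have cL := cont_comp (kpair_cont (@kify_cg _) cs ct) (@gfun_cont _ _ _ L).
  apply: cont_ext (cont_comp
    (kpair_cont (@kify_cg _) cL (cont_comp ci (@ksnd_cont _ _)))
    (@ass_app_cont _ _ _ _ _ S2)) => a /=.
  rewrite -KE chart_sectionK; congr K.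
  by rewrite [RHS]surjective_pairing.
have eK g (z : cyl R (btot S1)) : K (g \bullet z) = g \bullet K z.
  case: z => d t; have [phi [x <-]] := ass_app_surj d.
  have [gam gE] := ext_out_surj E g.
  have -> : (g \bullet ((ass_app phi x, t) : cyl R (btot S1))) =
      (ass_app (gam \bullet phi) (gam \bullet x), t).
    by rewrite ass_actE gactK -gE.
  by rewrite !KE (gfun_equiv L gam (phi, t)) ass_actE gactK -gE.
by exists (GMap cK eK).
Qed.

Definition ass_map (f : gmap (btot S1) (btot S2)) (h : gmap (bbase S1) (bbase S2))
  (fh : is_bundle_map f h) : gmap (ass_space S1) (ass_space S2).
Proof.
refine (@GMap _ (ass_space S1) (ass_space S2)
  (fun phi => ass_mk (fh.2 _ (ass_appP phi))) _ _).
  apply: ass_mk_cont; first exact: kify_cg.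
  exact: cont_comp (@ass_app_cont _ _ _ _ _ S1) (@gfun_cont _ _ _ f).
by move=> gam phi; apply: ass_ext => x; exact: gfun_equiv.
Defined.

Definition ass_homotopy (x0 : F) (H : gmap (cyl R (bbase S1)) (bbase S2)) :
  gmap (cyl R (ass_space S1)) (infl E (bbase S2)).
Proof.
refine (@GMap _ (cyl R (ass_space S1)) (infl E (bbase S2))
   (fun z : kprod (ass_space S1) (unitI R) => H (ass_proj S1 x0 z.1, z.2)) _ _).
  have c1 := cont_comp (@kfst_cont (ass_space S1) (unitI R))
    (@gfun_cont _ _ _ (ass_proj S1 x0)).
  exact: cont_comp (kpair_cont (@kify_cg _) c1 (@ksnd_cont (ass_space S1) (unitI R)))
    (@gfun_cont _ _ _ H).
move=> gam [phi t].
rewrite [X in H (X, _)](gfun_equiv (ass_proj S1 x0) gam phi).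
exact: (gfun_equiv H (ext_out E gam) (ass_proj S1 x0 phi, t)).
Defined.

Lemma fibration_ECHP (x0 : F) (f : gmap (btot S1) (btot S2))
    (h : gmap (bbase S1) (bbase S2)) (H : gmap (cyl R (bbase S1)) (bbase S2)) :
  h_fibration R (ass_proj S2 x0) -> is_bundle_map f h ->
  (forall b, H (cyl0 R _ b) = h b) ->
  exists K : gmap (cyl R (btot S1)) (btot S2),
    @is_bundle_map _ _ _ E F (cyl_bundle R S1) S2 K H /\
    (forall d, K (cyl0 R _ d) = f d).
Proof.
move=> fib fh H0.
have [phi|L [L0 pL]] := fib (ass_space S1) (ass_map fh) (ass_homotopy x0 H).
  by rewrite [LHS]fh.1 -H0.
have [K KE] := ass_homotopy_extend L; exists K; split; [split|].
- move=> [d t]; have [phi [x <-]] := ass_app_surj d.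
  rewrite KE [LHS](ass_projE x0) [LHS]pL.
  by congr (H (_, _)); apply/esym; exact: ass_projE.
- move=> u /cyl_admissibleP [psi [t [apsi ->]]].
  have := ass_appP (L (ass_mk apsi, t)).
  by congr (admissible _ _ _); apply/funext => x; rewrite -KE.
- move=> d; have [phi [x <-]] := ass_app_surj d.
  by rewrite [LHS]KE [L _]L0.
Qed.

End Extend.

(** * From the covering homotopy property to fibrations *)

Section PathSpace.
Variables (R : realType) (G : topGroupType) (B : gspace G).

Definition path_space : gspace G := gmapsp (unitI R) B.

Definition path_eval : gmap (cyl R path_space) B.
Proof.
refine (@GMap _ (cyl R path_space) B
  (fun z : kprod (kmap (unitI R) B) (unitI R) => kapp z.1 z.2) _ _) => //.
exact: keval_cont.
Defined.

Definition path_start : gmap path_space B.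
Proof.
refine (@GMap _ path_space B (fun w => path_eval (cyl0 R path_space w)) _ _) => //.
exact: cont_comp (@gfun_cont _ _ _ (cyl0 R path_space)) (@gfun_cont _ _ _ path_eval).
Defined.

End PathSpace.

Section ECHPFibration.
Variables (R : realType) (Pi Gam G : topGroupType) (E : extension Pi Gam G).
Variables (F : gspace Gam) (S : bundle E F).

(** The ECHP is used for a single test bundle, the pullback of [S] to the path
    space of its base, and the universal homotopy [path_eval]. *)
Lemma ECHP_fibration (x0 : F) : ECHP R S -> h_fibration R (ass_proj S x0).
Proof.
set B := bbase S; pose e0 := path_start R B.
move=> /(_ _ _ _ (pb_bundle_map e0) (path_eval R B) (fun _ => erefl)).
move=> [K [[pK aK] K0]] X f H fH.
have cH (x : X) : continuous (fun t => H (x, t) : B).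
  have c1 := kpair_cont (@cg_subproof (unitI R)) (@cont_cst (unitI R) X x)
    (fun t => cvg_id).
  exact: cont_comp c1 (@gfun_cont _ _ _ H).
pose w (x : X) : path_space R B := kabs (cH x).
have cw : continuous w.
  apply: kcurry_cont; first exact: gcg.
  by apply: cont_ext (@gfun_cont _ _ _ H) => -[x t].
have wE gam x : w (gam \bullet x) = ext_out E gam \bullet w x.
  apply: kapp_inj; apply/funext => t.
  exact: (gfun_equiv H gam (x, t)).
have e0E x y : e0 (w x) = bproj S (ass_app (f x) y).
  by rewrite [RHS](ass_projE x0) fH.
pose u (z : cyl R X) (y : F) : btot S := K (pb_mk (e0E z.1 y), z.2).
have au z : admissible E (batlas (b := S)) (u z).
  apply: aK; apply: (@cyl_admissible R _ _ _ _ _ (pb_bundle e0)).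
  exact: (pb_admissible (e0E z.1) x0 (ass_appP (f z.1))).
have cu : continuous (fun z : kprod (cyl R X) F => u z.1 z.2).
  have cgT := @kify_cg (cyl R X * F)%type.
  have cz := @kfst_cont (cyl R X) F.
  have cx := cont_comp cz (@kfst_cont X (unitI R)).
  have ct := cont_comp cz (@ksnd_cont X (unitI R)).
  have cf := cont_comp (kpair_cont cgT (cont_comp cx (@gfun_cont _ _ _ f))
    (@ksnd_cont (cyl R X) F)) (@ass_app_cont _ _ _ _ _ S).
  have cp := pb_mk_cont (h := e0) (sigma := bproj S)
    (b := fun z : kprod (cyl R X) F => w z.1.1)
    (e := fun z => e0E z.1.1 z.2) cgT (cont_comp cx cw) cf.
  exact: cont_comp (kpair_cont cgT cp ct) (@gfun_cont _ _ _ K).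
have lE gam z : ass_mk (au (gam \bullet z)) = gam \bullet ass_mk (au z).
  case: z => x t; apply: ass_ext => y; rewrite ass_actE.
  rewrite -[RHS](gfun_equiv K (ext_out E gam)
    (pb_mk (e0E x (gam^-1%g \bullet y)), t)).
  congr (K (_, t)); apply: pb_inj; first exact: wE.
  by have := congr1 (fun a => ass_app a y) (gfun_equiv f gam x).
exists (GMap (ass_mk_cont (a := au) (@gcg _ (cyl R X)) cu) lE).
split=> [x|[x t]]; first by apply: ass_ext => y; exact: K0.
exact: (pK (pb_mk (e0E x x0), t)).
Qed.

End ECHPFibration.

(** * The equivalence *)

(** Without points in the fibre there are no points in any total space, so that
    only the base points of admissible maps remain to be checked. *)
Lemma ECHP_empty_fibre (R : realType) (Pi Gam G : topGroupType)
    (E : extension Pi Gam G) (F : gspace Gam) (S : bundle E F) :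
  (F -> False) -> ECHP R S.
Proof.
move=> noF S1 f h fh H H0.
have noD (d : btot S1) : False by have [_ [x _]] := ass_app_surj d.
pose k (z : cyl R (btot S1)) : btot S := False_rect _ (noD z.1).
have ck : continuous k by move=> z; case: (noD z.1).
have ek g z : k (g \bullet z) = g \bullet k z by case: (noD z.1).
exists (GMap ck ek); split; last by move=> d; case: (noD d).
split=> [z|u [cu [b [_ _]]]]; first by case: (noD z.1).
split; first by move=> x; case: (noF x).
exists (H b); split=> [x|c v _ _]; first by case: (noF x).
by exists 1%g => x; case: (noF x).
Qed.

Theorem lemma10 (R : realType) (Pi Gam G : topGroupType)
    (hPi : compact_lie_group R Pi) (hGam : compact_lie_group R Gam)
    (hG : compact_lie_group R G) (E : extension Pi Gam G)
    (F : gspace Gam) (hF : effective E F) (S : bundle E F) :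
  ECHP R S <-> h_fibration R (ass_p S).
Proof.
rewrite /ass_p /ass_total /Ass; case: pselect => [nF|nF] /=.
  split; first exact: ECHP_fibration.
  by move=> fib S1 f h fh H H0; exact: fibration_ECHP fib fh H0.
split=> _; first by move=> X f h fh; exists h; split=> // a; rewrite -fh.
by apply: ECHP_empty_fibre => x; apply: nF; exists x.
Qed.
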